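(* Let $\mathcal P$ be the fractional periodic timetabling polytope of a PESP instance $(G,T,\ell,u,w)$, $G=(V,A)$. Let $(x,z)\in\mathcal P$, let $\gamma\in\mathcal C$ with $\gamma^\top x\notin T\mathbb Z$, and set $g:=T/[-\gamma^\top x]_T$. Then the flip inequality with respect to $\gamma$ and $$F:=\{a\in A\mid\gamma_a>0\text{ and }u_a-\ell_a\ge g(u_a-x_a)\}\cup\{a\in A\mid\gamma_a<0\text{ and }u_a-\ell_a\le g(x_a-\ell_a)\}$$ is maximally violated by $(x,z)$ among the flip inequalities with respect to $\gamma$; that is, if $(x,z)$ violates the flip inequality for $(\gamma,F')$ for some $F'\subseteq A$, then the right-hand side minus the left-hand side of the flip inequality for $(\gamma,F)$ at $(x,z)$ is maximum among the corresponding differences for all $(\gamma,F')$ with $F'\subseteq A$. In particular, a maximally violated flip inequality with respect to $\gamma$ can be found in $O(|\gamma|)$ time, where $|\gamma|=|\{a\in A\mid\gamma_a\ne 0\}|$.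
   Context: A PESP instance $(G,T,\ell,u,w)$ consists of a finite weakly connected directed graph $G=(V,A)$, a period $T\in\mathbb N$, $T\ge 2$, bounds $\ell,u\in\mathbb Z^A$ and weights $w\in\mathbb R^A$. The cycle space is $\mathcal C=\{\gamma\in\mathbb Z^A \mid \sum_{a\in\delta^+(i)}\gamma_a=\sum_{a\in\delta^-(i)}\gamma_a\ \forall i\in V\}$, of rank $\mu=|A|-|V|+1$. An oriented cycle is an element of $\mathcal C\cap\{-1,0,1\}^A$. An integral cycle basis is a set $B$ of $\mu$ oriented cycles forming a $\mathbb Z$-basis of $\mathcal C$; its cycle matrix $\Gamma\in\{-1,0,1\}^{B\times A}$ has the elements of $B$ as rows. The fractional periodic timetabling polytope (with respect to $B$) is $\mathcal P=\{(x,z)\in\mathbb R^A\times\mathbb R^B\mid \Gamma x=Tz,\ \ell\le x\le u\}$. $[y]_T\in[0,T)$ denotes $y$ modulo $T$. For $\gamma\in\mathcal C$, $F\subseteq A$ set $\alpha=\alpha_{\gamma,F}=[-\sum_{a\in A\setminus F}\gamma_a\ell_a-\sum_{a\in F}\gamma_a u_a]_T$. The flip inequality for $(\gamma,F)$ is $$(T-\alpha)\sum_{a\in A\setminus F,\gamma_a>0}\gamma_a(x_a-\ell_a)+\alpha\sum_{a\in A\setminus F,\gamma_a<0}(-\gamma_a)(x_a-\ell_a)+\alpha\sum_{a\in F,\gamma_a>0}\gamma_a(u_a-x_a)+(T-\alpha)\sum_{a\in F,\gamma_a<0}(-\gamma_a)(u_a-x_a)\ \ge\ \alpha(T-\alpha).$$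 *)

(* Defs.v *)
From HB Require Import structures.
From mathcomp Require Import all_boot all_order all_algebra.
From mathcomp Require Import finmap reals.

Set Implicit Arguments.
Unset Strict Implicit.
Unset Printing Implicit Defensive.

Import Order.TTheory GRing.Theory Num.Theory.

Local Open Scope ring_scope.

(* Arcs form a type of their own, so parallel arcs are allowed. *)
Record pesp (R : realType) := Pesp {
  vertices : finType;
  arcs : finType;
  src : arcs -> vertices;
  tgt : arcs -> vertices;
  period : nat;
  lower : {ffun arcs -> int};
  upper : {ffun arcs -> int};
  weight : {ffun arcs -> R};
  vertex_gt0 : (0 < #|vertices|)%N;
  weakly_connected : forall i j : vertices,
    connect [rel v w | [exists a, ((src a == v) && (tgt a == w))
                               || ((src a == w) && (tgt a == v))]] i j;
  period_ge2 : (2 <= period)%N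
}.

Section Timetabling.
Variables (R : realType) (I : pesp R).

Definition in_cycle_space (g : {ffun arcs I -> int}) : Prop :=
  forall i : vertices I,
    \sum_(a : arcs I | src a == i) g a = \sum_(a : arcs I | tgt a == i) g a.

Definition oriented_cycle (g : {ffun arcs I -> int}) : Prop :=
  in_cycle_space g /\ forall a, g a \in [:: -1; 0; 1].

(* The truncated subtraction is exact: a weakly connected graph has at least
   #|V| - 1 arcs. *)
Definition cyclomatic_number : nat := (#|arcs I|.+1 - #|vertices I|)%N.

Definition integral_cycle_basis (B : {fset {ffun arcs I -> int}}) : Prop :=
  [/\ #|` B|%fset = cyclomatic_number,
      forall b, b \in B -> oriented_cycle b,
      (forall g, in_cycle_space g ->
        exists c : {ffun B -> int}, g = \sum_(b : B) val b *~ c b)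
    & (forall c : {ffun B -> int},
        \sum_(b : B) val b *~ c b = 0 -> forall b, c b = 0)].

Definition cycle_matrix (B : {fset {ffun arcs I -> int}}) (b : B) (a : arcs I)
  : int := val b a.

Definition in_polytope (B : {fset {ffun arcs I -> int}})
    (x : {ffun arcs I -> R}) (z : {ffun B -> R}) : Prop :=
  (forall b : B,
     \sum_(a : arcs I) (cycle_matrix b a)%:~R * x a = (period I)%:R * z b) /\
  (forall a, (lower I a)%:~R <= x a <= (upper I a)%:~R).

Definition tension (g : {ffun arcs I -> int}) (x : {ffun arcs I -> R}) : R :=
  \sum_(a : arcs I) (g a)%:~R * x a.

Definition modT (y : R) : R :=
  y - (period I)%:R * (Num.floor (y / (period I)%:R))%:~R.

Definition flip_alpha (g : {ffun arcs I -> int}) (F : {set arcs I}) : R :=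
  modT (- (\sum_(a | a \notin F) (g a)%:~R * (lower I a)%:~R)
        - \sum_(a in F) (g a)%:~R * (upper I a)%:~R).

Definition flip_lhs (g : {ffun arcs I -> int}) (F : {set arcs I})
    (x : {ffun arcs I -> R}) : R :=
  let T := (period I)%:R in
  let alpha := flip_alpha g F in
    (T - alpha) * (\sum_(a | (a \notin F) && (0 < g a))
                      (g a)%:~R * (x a - (lower I a)%:~R))
  + alpha * (\sum_(a | (a \notin F) && (g a < 0))
                      (- g a)%:~R * (x a - (lower I a)%:~R))
  + alpha * (\sum_(a | (a \in F) && (0 < g a))
                      (g a)%:~R * ((upper I a)%:~R - x a))
  + (T - alpha) * (\sum_(a | (a \in F) && (g a < 0))
                      (- g a)%:~R * ((upper I a)%:~R - x a)).

Definition flip_rhs (g : {ffun arcs I -> int}) (F : {set arcs I}) : R :=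
  flip_alpha g F * ((period I)%:R - flip_alpha g F).

Definition violates_flip (x : {ffun arcs I -> R}) (g : {ffun arcs I -> int})
    (F : {set arcs I}) : Prop :=
  ~ (flip_rhs g F <= flip_lhs g F x).

Definition flip_violation (x : {ffun arcs I -> R}) (g : {ffun arcs I -> int})
    (F : {set arcs I}) : R :=
  flip_rhs g F - flip_lhs g F x.

Definition maximally_violated (x : {ffun arcs I -> R})
    (g : {ffun arcs I -> int}) (F : {set arcs I}) : Prop :=
  (exists F', violates_flip x g F') ->
  forall F', flip_violation x g F' <= flip_violation x g F.

Definition flip_set (g : {ffun arcs I -> int}) (x : {ffun arcs I -> R})
  : {set arcs I} :=
  let r := (period I)%:R / modT (- tension g x) in
  [set a | (0 < g a) &&
     (r * ((upper I a)%:~R - x a) <= (upper I a)%:~R - (lower I a)%:~R)] :|: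
  [set a | (g a < 0) &&
     ((upper I a)%:~R - (lower I a)%:~R <= r * (x a - (lower I a)%:~R))].

Definition support_size (g : {ffun arcs I -> int}) : nat :=
  #|[set a | g a != 0]|.

End Timetabling.

(* A real RAM, used to give a meaning to running times.  Its memory consists of
   numbered arrays, of integers and of reals, each indexed by integers.  Every
   elementary operation (memory access, arithmetic operation, rounding,
   comparison, assignment, branching) costs one unit; the floor operation is
   there because of the residues modulo T.  Only integer constants may occur in
   a program. *)

Inductive iexpr :=
| IConst of int
| IGet of nat & iexpr
| IAdd of iexpr & iexpr
| ISub of iexpr & iexpr.

Inductive rexpr :=
| RCast of iexpr
| RGet of nat & iexpr
| RAdd of rexpr & rexpr
| RSub of rexpr & rexpr
| RMul of rexpr & rexpr
| RDiv of rexpr & rexpr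
| RFloor of rexpr.

Inductive test :=
| ILt of iexpr & iexpr
| RLe of rexpr & rexpr.

Inductive prog :=
| Skip
| ISet of nat & iexpr & iexpr
| RSet of nat & iexpr & rexpr
| Seq of prog & prog
| If of test & prog & prog
| While of test & prog.

Fixpoint icost (e : iexpr) : nat :=
  match e with
  | IConst _ => 1
  | IGet _ i => (icost i).+1
  | IAdd e1 e2 | ISub e1 e2 => (icost e1 + icost e2).+1
  end.

Fixpoint rcost (e : rexpr) : nat :=
  match e with
  | RCast e' => (icost e').+1
  | RGet _ i => (icost i).+1
  | RAdd e1 e2 | RSub e1 e2 | RMul e1 e2 | RDiv e1 e2 =>
      (rcost e1 + rcost e2).+1
  | RFloor e' => (rcost e').+1
  end.

Definition tcost (t : test) : nat :=
  match t with
  | ILt e1 e2 => (icost e1 + icost e2).+1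
  | RLe e1 e2 => (rcost e1 + rcost e2).+1
  end.

Section RealRam.
Variable R : realType.

Record memory := Memory {
  imem : nat -> int -> int;
  rmem : nat -> int -> R
}.

Fixpoint ieval (m : memory) (e : iexpr) : int :=
  match e with
  | IConst k => k
  | IGet arr i => imem m arr (ieval m i)
  | IAdd e1 e2 => ieval m e1 + ieval m e2
  | ISub e1 e2 => ieval m e1 - ieval m e2
  end.

Fixpoint reval (m : memory) (e : rexpr) : R :=
  match e with
  | RCast e' => (ieval m e')%:~R
  | RGet arr i => rmem m arr (ieval m i)
  | RAdd e1 e2 => reval m e1 + reval m e2
  | RSub e1 e2 => reval m e1 - reval m e2
  | RMul e1 e2 => reval m e1 * reval m e2
  | RDiv e1 e2 => reval m e1 / reval m e2
  | RFloor e' => (Num.floor (reval m e'))%:~R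
  end.

Definition teval (m : memory) (t : test) : bool :=
  match t with
  | ILt e1 e2 => ieval m e1 < ieval m e2
  | RLe e1 e2 => reval m e1 <= reval m e2
  end.

Definition upd (S : Type) (f : nat -> int -> S) (arr : nat) (i : int) (v : S)
  : nat -> int -> S :=
  fun arr' i' => if (arr' == arr) && (i' == i) then v else f arr' i'.

(* [exec p m n m']: started in memory m, the program p halts in memory m'
   after n units of time. *)
Inductive exec : prog -> memory -> nat -> memory -> Prop :=
| ExecSkip m : exec Skip m 1 m
| ExecISet arr i e m :
    exec (ISet arr i e) m (icost i + icost e).+1
      (Memory (upd (imem m) arr (ieval m i) (ieval m e)) (rmem m))
| ExecRSet arr i e m :
    exec (RSet arr i e) m (icost i + rcost e).+1
      (Memory (imem m) (upd (rmem m) arr (ieval m i) (reval m e)))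
| ExecSeq p q m n1 m1 n2 m2 :
    exec p m n1 m1 -> exec q m1 n2 m2 -> exec (Seq p q) m (n1 + n2) m2
| ExecIfTrue t p q m n m' :
    teval m t -> exec p m n m' -> exec (If t p q) m (tcost t + n).+1 m'
| ExecIfFalse t p q m n m' :
    ~~ teval m t -> exec q m n m' -> exec (If t p q) m (tcost t + n).+1 m'
| ExecWhileTrue t p m n1 m1 n2 m2 :
    teval m t -> exec p m n1 m1 -> exec (While t p) m1 n2 m2 ->
    exec (While t p) m (tcost t + n1 + n2).+1 m2
| ExecWhileFalse t p m :
    ~~ teval m t -> exec (While t p) m (tcost t).+1 m.

End RealRam.

Section InputOutput.
Variables (R : realType) (I : pesp R).

Definition arc_number (a : arcs I) : int := (enum_rank a : nat)%:Z.

(* Input: integer array 0 holds T and |g|; arrays 1 and 2 hold the sparse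
   representation of g, as a list, in any order, of the numbers of the arcs of
   its support and of the corresponding entries; arrays 3 and 4 hold the bounds
   and real array 0 holds x, each indexed by arc numbers.  The initial contents
   of all other cells are arbitrary. *)
Definition input_memory (g : {ffun arcs I -> int}) (x : {ffun arcs I -> R})
    (m : memory R) : Prop :=
  exists s : seq (arcs I),
    [/\ uniq s /\ (forall a, (a \in s) = (g a != 0)),
        imem m 0 0 = (period I)%:Z /\ imem m 0 1 = (support_size g)%:Z,
        (forall (j : nat) (a : arcs I), onth s j = Some a ->
           imem m 1 j%:Z = arc_number a /\ imem m 2 j%:Z = g a)
      & (forall a, [/\ imem m 3 (arc_number a) = lower I a,
                       imem m 4 (arc_number a) = upper I a
                     & rmem m 0 (arc_number a) = x a])].

(* Output: the size of F in integer array 5, and the list of the numbers of the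
   arcs of F in integer array 6. *)
Definition output_memory (m : memory R) (F : {set arcs I}) : Prop :=
  exists s : seq (arcs I),
    [/\ uniq s /\ (forall a, (a \in s) = (a \in F)),
        imem m 5 0 = (size s)%:Z
      & (forall (j : nat) (a : arcs I), onth s j = Some a ->
           imem m 6 j%:Z = arc_number a)].

End InputOutput.

(* Main.v *)
(** Let b in (0, T) be the residue of minus the tension of x along the cycle.
    Writing P (resp. N) for the sum of the slack terms that move the residue
    alpha up (resp. down), alpha = b + P - N up to a multiple of T, and the left
    side of the flip inequality is (T - alpha) P + alpha N.  If the multiple is
    0 the violation equals b (T - b) - (T - b) N - b P, which is additive over the
    arcs; otherwise the inequality holds.  The given set minimizes
    (T - b) N + b P arc by arc, and a positive value of the additive expression
    forces P < T - b and N < b, so that the multiple is 0 for it.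

    Two passes over the support compute the set: the first accumulates the
    tension, the second tests the condition for each arc. *)

Require Import Defs.
From HB Require Import structures.
From mathcomp Require Import all_boot all_order all_algebra.
From mathcomp Require Import finmap reals.
From mathcomp Require Import ring lra zify.

Set Implicit Arguments.
Unset Strict Implicit.
Unset Printing Implicit Defensive.

Import Order.TTheory GRing.Theory Num.Theory.

Local Open Scope ring_scope.

(** * The flip inequality in terms of slacks raising or lowering the residue *)

Section FlipInequalities.
Variables (R : realType) (I : pesp R).
Implicit Types (g : {ffun arcs I -> int}) (x : {ffun arcs I -> R}).
Implicit Types (F : {set arcs I}).

Local Notation T := ((period I)%:R : R).
Local Notation l a := ((lower I a)%:~R : R).
Local Notation u a := ((upper I a)%:~R : R).

Lemma period_gt0 : 0 < T.
Proof. by rewrite ltr0n (leq_trans _ (period_ge2 I)). Qed.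

Lemma modT_bounds (y : R) : 0 <= modT I y < T.
Proof.
have T0 := period_gt0; rewrite /modT.
have := Num.Theory.floor_itv (y / T); move: (Num.floor _) => k.
by rewrite rmorphD /= ler_pdivlMr // ltr_pdivrMr //; lra.
Qed.

Lemma flip_alpha_bounds g F : 0 <= flip_alpha g F < T.
Proof. exact: modT_bounds. Qed.

Lemma modT_neg_tension_gt0 g x :
  ~ (exists k : int, tension g x = T * k%:~R) -> 0 < modT I (- tension g x).
Proof.
move=> ntk; have /andP[+ _] := modT_bounds (- tension g x).
rewrite le_eqVlt => /orP[/eqP e|//]; case: ntk.
exists (- Num.floor (- tension g x / T)); move: e.
by rewrite /modT rmorphN /=; lra.
Qed.

Definition raising_slack g x F : R :=
  \sum_(a | (a \notin F) && (0 < g a)) (g a)%:~R * (x a - l a)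
  + \sum_(a | (a \in F) && (g a < 0)) (- g a)%:~R * (u a - x a).

Definition lowering_slack g x F : R :=
  \sum_(a | (a \notin F) && (g a < 0)) (- g a)%:~R * (x a - l a)
  + \sum_(a | (a \in F) && (0 < g a)) (g a)%:~R * (u a - x a).

(** Contribution of a single arc, extended by 0 so that the slack sums of different sets [F] run
    over the same arcs and compare termwise. *)
Definition arc_raising g x F a : R :=
  if a \in F then if g a < 0 then (- g a)%:~R * (u a - x a) else 0
  else if 0 < g a then (g a)%:~R * (x a - l a) else 0.

Definition arc_lowering g x F a : R :=
  if a \in F then if 0 < g a then (g a)%:~R * (u a - x a) else 0
  else if g a < 0 then (- g a)%:~R * (x a - l a) else 0.

Lemma raising_slackE g x F : raising_slack g x F = \sum_a arc_raising g x F a.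
Proof.
rewrite /raising_slack big_mkcond [X in _ + X]big_mkcond -big_split /=.
apply: eq_bigr => a _; rewrite /arc_raising.
by case: (a \in F); rewrite /= ?addr0 ?add0r.
Qed.

Lemma lowering_slackE g x F :
  lowering_slack g x F = \sum_a arc_lowering g x F a.
Proof.
rewrite /lowering_slack big_mkcond [X in _ + X]big_mkcond -big_split /=.
apply: eq_bigr => a _; rewrite /arc_lowering.
by case: (a \in F); rewrite /= ?addr0 ?add0r.
Qed.

Lemma flip_lhsE g x F :
  flip_lhs g F x = (T - flip_alpha g F) * raising_slack g x F
                   + flip_alpha g F * lowering_slack g x F.
Proof. by rewrite /flip_lhs /raising_slack /lowering_slack; ring. Qed.

(** Replacing [x a] by [l a] or [u a] in minus the tension changes it by [g a * (x a - l a)] or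
    [- g a * (u a - x a)]; the sign of [g a] decides which slack absorbs the change. *)
Lemma flip_alphaE g x F : exists k : int,
  flip_alpha g F = modT I (- tension g x) + raising_slack g x F
                   - lowering_slack g x F - T * k%:~R.
Proof.
rewrite /flip_alpha.
have -> : - (\sum_(a | a \notin F) (g a)%:~R * l a)
      - \sum_(a in F) (g a)%:~R * u a = - tension g x + raising_slack g x F
        - lowering_slack g x F.
  rewrite raising_slackE lowering_slackE /tension -!sumrN.
  rewrite big_mkcond [X in _ + X]big_mkcond -!big_split /=.
  apply: eq_bigr => a _; rewrite /arc_raising /arc_lowering.
  case: (a \in F); case: (ltrgtP (g a) 0) => [ga|ga|->] /=;
    by rewrite ?rmorphN /=; ring.
rewrite /modT; set y := - _ + _ - _.
exists (Num.floor (y / T) - Num.floor (- tension g x / T)).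
by rewrite rmorphB /= /y; ring.
Qed.

(** * Maximal violation at a point within the bounds *)

Section FeasiblePoint.
Variables (x : {ffun arcs I -> R}) (g : {ffun arcs I -> int}).
Hypothesis x_bounded : forall a, l a <= x a <= u a.
Hypothesis g_fractional : ~ (exists k : int, tension g x = T * k%:~R).

Local Notation beta := (modT I (- tension g x)).
Local Notation P := (raising_slack g x).
Local Notation N := (lowering_slack g x).

Lemma raising_slack_ge0 F : 0 <= P F.
Proof.
by rewrite addr_ge0 // sumr_ge0 // => a /andP[_ ga];
  have /andP[? ?] := x_bounded a;
  rewrite mulr_ge0 ?subr_ge0 // ler0z ?oppr_ge0 ltW.
Qed.

Lemma lowering_slack_ge0 F : 0 <= N F.
Proof.
by rewrite addr_ge0 // sumr_ge0 // => a /andP[_ ga];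
  have /andP[? ?] := x_bounded a;
  rewrite mulr_ge0 ?subr_ge0 // ler0z ?oppr_ge0 ltW.
Qed.

Definition linear_violation F : R :=
  beta * (T - beta) - (T - beta) * N F - beta * P F.

(* If the multiple of T is nonzero, then [alpha < P F] or [T - alpha < N F]. *)
Lemma flip_violation_le0_or_linear F :
  flip_violation x g F <= 0 \/ flip_violation x g F = linear_violation F.
Proof.
have [k ak] := flip_alphaE g x F.
have /andP[a0 aT] := flip_alpha_bounds g F.
have b0 := modT_neg_tension_gt0 g_fractional.
have /andP[_ bT] := modT_bounds (- tension g x).
have p0 := raising_slack_ge0 F; have n0 := lowering_slack_ge0 F.
rewrite /flip_violation /flip_rhs flip_lhsE /linear_violation.
move: ak a0 aT b0 bT p0 n0; move: (flip_alpha g F) beta (P F) (N F) period_gt0.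
move: T => t a b p n t0 ak a0 aT b0 bT p0 n0.
case: (ltrgtP k 0) => [k0|k0|k0].
(* Here [n > t - a], so [a * n] alone covers the right-hand side; for [k > 0], [p > a] and
   [(t - a) * p] covers it. *)
- left; have {}k0 : k%:~R <= -1 :> R by rewrite -[-1]/((-1)%:~R) ler_int; lia.
  have : t * k%:~R <= t * -1 by rewrite ler_pM2l.
  by nra.
- left; have {}k0 : 1 <= k%:~R :> R by rewrite -[1]/(1%:~R) ler_int; lia.
  have : t * 1 <= t * k%:~R by rewrite ler_pM2l.
  by nra.
- by right; rewrite ak k0 mulr0; ring.
Qed.

Lemma flip_violation_linear F :
  0 < linear_violation F -> flip_violation x g F = linear_violation F.
Proof.
have [k ak] := flip_alphaE g x F.
have /andP[a0 aT] := flip_alpha_bounds g F.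
have b0 := modT_neg_tension_gt0 g_fractional.
have /andP[_ bT] := modT_bounds (- tension g x).
have p0 := raising_slack_ge0 F; have n0 := lowering_slack_ge0 F.
rewrite /flip_violation /flip_rhs flip_lhsE /linear_violation.
move: ak a0 aT b0 bT p0 n0; move: (flip_alpha g F) beta (P F) (N F) period_gt0.
move: T => t a b p n t0 ak a0 aT b0 bT p0 n0 L0.
have pb : p < t - b by rewrite -(ltr_pM2l b0); nra.
have nb : n < b by rewrite -(@ltr_pM2l _ (t - b)) ?subr_gt0 //; nra.
suff k0 : k = 0 by rewrite ak k0 mulr0; ring.
(* By [pb] and [nb], [b + p - n] lies strictly between [0] and [t]; as [a] lies in [[0, t)], their
   difference [t * k] lies strictly between [-t] and [t]. *)
have : t * k%:~R < t * 1 by lra.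
have : t * -1 < t * k%:~R by lra.
rewrite !ltr_pM2l // -[1]/(1%:~R) -rmorphN /= !ltr_int; lia.
Qed.

(** Up to the factor [|g a|], an arc with [g a > 0] costs [(T - beta) * (u a - x a)] inside the set
    and [beta * (x a - l a)] outside. Inside is no dearer iff
    [T * (u a - x a) <= beta * (u a - l a)], which is the membership test. For [g a < 0] the costs
    are [beta * (u a - x a)] inside and [(T - beta) * (x a - l a)] outside. *)
Lemma linear_violation_flip_set F :
  linear_violation F <= linear_violation (flip_set g x).
Proof.
suff : (T - beta) * N (flip_set g x) + beta * P (flip_set g x)
       <= (T - beta) * N F + beta * P F by rewrite /linear_violation; lra.
rewrite !raising_slackE !lowering_slackE !mulr_sumr -!big_split /=.
apply: ler_sum => a _; rewrite /arc_raising /arc_lowering !inE.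
have b0 := modT_neg_tension_gt0 g_fractional.
have rM (c d : R) : (T / beta * c <= d) = (T * c <= beta * d).
  by rewrite mulrAC ler_pdivrMr // [d * _]mulrC.
have Mr (c d : R) : (d <= T / beta * c) = (beta * d <= T * c).
  by rewrite mulrAC ler_pdivlMr // [d * _]mulrC.
rewrite rM Mr.
case: (ltrgtP (g a) 0) => [ga|ga|_]; rewrite ?orbF /=.
- have {}ga : 0 < (- g a)%:~R :> R by rewrite ltr0z oppr_gt0.
  case: ifPn => [h|]; last (rewrite -ltNge => h); case: ifP => _;
    by rewrite ?mulr0 ?add0r ?addr0 ![_ * (_%:~R * _)]mulrCA ler_pM2l //; lra.
- have {}ga : 0 < (g a)%:~R :> R by rewrite ltr0z.
  case: ifPn => [h|]; last (rewrite -ltNge => h); case: ifP => _;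
    by rewrite ?mulr0 ?add0r ?addr0 ![_ * (_%:~R * _)]mulrCA ler_pM2l //; lra.
- by case: ifP => _; rewrite !mulr0.
Qed.

Lemma flip_set_maximally_violated : maximally_violated x g (flip_set g x).
Proof.
move=> [F' /negP]; rewrite -ltNge -subr_gt0 -/(flip_violation x g F') => V0.
(* A violated [F'] has positive linear violation, hence so has the maximizer [flip_set g x], whose
   true violation is then the linear one. *)
have L0 : 0 < linear_violation (flip_set g x).
  apply: lt_le_trans (linear_violation_flip_set F').
  by case: (flip_violation_le0_or_linear F') => [|<-//]; rewrite leNgt V0.
move=> F; rewrite (flip_violation_linear L0).
case: (flip_violation_le0_or_linear F) => [V|->].
  exact: le_trans V (ltW L0).
exact: linear_violation_flip_set.
Qed.

End FeasiblePoint.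
End FlipInequalities.

(** * Execution and cost of loop-free programs and counted loops *)

Fixpoint loop_free (p : prog) : bool :=
  match p with
  | Skip | ISet _ _ _ | RSet _ _ _ => true
  | Seq p q | If _ p q => loop_free p && loop_free q
  | While _ _ => false
  end.

Fixpoint cost_bound (p : prog) : nat :=
  match p with
  | Skip => 1
  | ISet _ i e => (icost i + icost e).+1
  | RSet _ i e => (icost i + rcost e).+1
  | Seq p q => cost_bound p + cost_bound q
  | If t p q => (tcost t + maxn (cost_bound p) (cost_bound q)).+1
  | While _ _ => 0
  end.

(* [While] is given junk values here and in [cost_bound]. *)
Fixpoint run (R : realType) (p : prog) (m : memory R) : memory R :=
  match p with
  | Skip | While _ _ => m
  | ISet arr i e =>
      Memory (upd (imem m) arr (ieval m i) (ieval m e)) (rmem m)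
  | RSet arr i e =>
      Memory (imem m) (upd (rmem m) arr (ieval m i) (reval m e))
  | Seq p q => run q (run p m)
  | If t p q => if teval m t then run p m else run q m
  end.

(** Lets loop bodies be verified by evaluating [run], leaving only loops to be treated through
    [exec]. *)
Lemma exec_loop_free (R : realType) (p : prog) (m : memory R) :
  loop_free p -> exists2 n, exec p m n (run p m) & (n <= cost_bound p)%N.
Proof.
elim: p m => [|arr i e|arr i e|p IHp q IHq|t p IHp q IHq|//] m /=.
- by exists 1%N => //; apply: ExecSkip.
- by eexists; first exact: ExecISet.
- by eexists; first exact: ExecRSet.
- move=> /andP[/(IHp m)[n1 e1 c1] /(IHq (run p m))[n2 e2 c2]].
  by exists (n1 + n2)%N; [apply: ExecSeq e1 e2 | rewrite leq_add].
- move=> /andP[/(IHp m)[n1 e1 c1] /(IHq m)[n2 e2 c2]].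
  case: ifPn => tm.
    exists (tcost t + n1).+1; first exact: ExecIfTrue.
    by rewrite ltnS leq_add2l (leq_trans c1) ?leq_maxl.
  exists (tcost t + n2).+1; first exact: ExecIfFalse.
  by rewrite ltnS leq_add2l (leq_trans c2) ?leq_maxr.
Qed.

(** Induction on the number of remaining rounds; the last summand of the bound pays for the final
    failing test. *)
Lemma exec_while (R : realType) (t : test) (p : prog)
    (inv : nat -> memory R -> Prop) (n : nat) :
  loop_free p ->
  (forall j m, (j < n)%N -> inv j m -> teval m t /\ inv j.+1 (run p m)) ->
  (forall m, inv n m -> ~~ teval m t) ->
  forall m, inv 0%N m -> exists (k : nat) (m' : memory R),
    [/\ exec (While t p) m k m',
        (k <= n * (tcost t + cost_bound p).+1 + (tcost t).+1)%N & inv n m'].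
Proof.
move=> lfp step stop m; rewrite -{1}(subnn n).
suff loop d m1 : (d <= n)%N -> inv (n - d)%N m1 -> exists (k : nat) m',
    [/\ exec (While t p) m1 k m',
        (k <= d * (tcost t + cost_bound p).+1 + (tcost t).+1)%N & inv n m'].
  exact: loop.
elim: d m1 => [|d IHd] m1 led.
  rewrite subn0 => im; exists (tcost t).+1, m1; split=> //.
  exact/ExecWhileFalse/stop.
move=> im; have [|tm im'] := step _ _ _ im.
  by rewrite ltn_subrL; case: (n) led.
rewrite -subSn // subSS in im'.
have [k [m' [e kle im2]]] := IHd _ (ltnW led) im'.
have [c ec cle] := exec_loop_free m1 lfp.
exists (tcost t + c + k).+1, m'; split=> //.
  exact: ExecWhileTrue ec e.
by rewrite mulSn; lia.
Qed.

Definition for_support (p : prog) : prog :=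
  Seq (ISet 7 (IConst 0) (IConst 0))
    (While (ILt (IGet 7 (IConst 0)) (IGet 0 (IConst 1)))
       (Seq p (ISet 7 (IConst 0) (IAdd (IGet 7 (IConst 0)) (IConst 1))))).

(** Test, branching and increment take [5 + 1 + 6 = 12] units per round, within the [13] allowed;
    initialization and the last test take [3 + 6 = 9]. *)
Lemma exec_for_support (R : realType) (p : prog)
    (inv : nat -> memory R -> Prop) (n : nat) :
  loop_free p ->
  (forall j m, inv j m -> imem m 0 1 = n%:Z) ->
  (forall j k m, inv j m ->
     inv j (Memory (upd (imem m) 7 0 k) (rmem m))) ->
  (forall j m, (j < n)%N -> imem m 7 0 = j%:Z -> inv j m ->
     inv j.+1 (run p m) /\ imem (run p m) 7 0 = j%:Z) ->
  forall m, inv 0%N m -> exists (k : nat) (m' : memory R),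
    [/\ exec (for_support p) m k m',
        (k <= n * (cost_bound p + 13) + 9)%N & inv n m'].
Proof.
move=> lfp size_n keep step m im.
pose body := Seq p (ISet 7 (IConst 0) (IAdd (IGet 7 (IConst 0)) (IConst 1))).
pose t := ILt (IGet 7 (IConst 0)) (IGet 0 (IConst 1)).
have [|j m1 jn [im1 m1j]|m1 [im1 m1n]||k [m' [e kle [im' _]]]] :=
  @exec_while R t body (fun j m => inv j m /\ imem m 7 0 = j%:Z) n _ _ _
    (Memory (upd (imem m) 7 0 0) (rmem m)).
- by rewrite /= lfp.
- have [im2 m2j] := step _ _ jn m1j im1.
  split; first by rewrite /= m1j (size_n _ _ im1).
  by split; [apply: keep | rewrite /= m2j /upd /=; lia].
- by rewrite /= m1n (size_n _ _ im1) ltxx.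
- by split; first exact: keep.
exists (3 + k)%N, m'; split=> //; first by apply: ExecSeq e; apply: ExecISet.
by move: kle; rewrite /= /muln_rec; lia.
Qed.

(* Integer cell 7[0] is the loop counter; real cells 1[0] and 1[1] hold minus
   the tension and the ratio of the period to its residue. *)
Definition entry (arr : nat) : iexpr := IGet arr (IGet 7 (IConst 0)).
Definition arc_lower : rexpr := RCast (IGet 3 (entry 1)).
Definition arc_upper : rexpr := RCast (IGet 4 (entry 1)).
Definition arc_value : rexpr := RGet 0 (entry 1).
Definition neg_tension : rexpr := RGet 1 (IConst 0).
Definition ratio : rexpr := RGet 1 (IConst 1).
Definition period_expr : rexpr := RCast (IGet 0 (IConst 0)).

Definition subtract_arc_tension : prog :=
  RSet 1 (IConst 0) (RSub neg_tension (RMul (RCast (entry 2)) arc_value)).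

Definition output_arc : prog :=
  Seq (ISet 6 (IGet 5 (IConst 0)) (entry 1))
      (ISet 5 (IConst 0) (IAdd (IGet 5 (IConst 0)) (IConst 1))).

(** Listed entries are nonzero, so the outer else branch is the negative case. *)
Definition select_arc : prog :=
  If (ILt (IConst 0) (entry 2))
    (If (RLe (RMul ratio (RSub arc_upper arc_value))
             (RSub arc_upper arc_lower)) output_arc Skip)
    (If (RLe (RSub arc_upper arc_lower)
             (RMul ratio (RSub arc_value arc_lower))) output_arc Skip).

Definition set_ratio : prog :=
  Seq (RSet 1 (IConst 1)
         (RDiv period_expr
            (RSub neg_tension
               (RMul period_expr (RFloor (RDiv neg_tension period_expr))))))
      (ISet 5 (IConst 0) (IConst 0)).

Definition flip_set_prog : prog :=
  Seq (RSet 1 (IConst 0) (RCast (IConst 0)))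
    (Seq (for_support subtract_arc_tension)
       (Seq set_ratio (for_support select_arc))).

(** * Correctness and linear running time of the program *)

Section FlipSetProgram.
Variables (R : realType) (I : pesp R).
Variables (g : {ffun arcs I -> int}) (x : {ffun arcs I -> R}).

(** The memory part of [input_memory] for a fixed list [s], so that both passes share one list. *)
Definition input_listing (s : seq (arcs I)) (m : memory R) : Prop :=
  [/\ imem m 0 0 = (period I)%:Z /\ imem m 0 1 = (size s)%:Z,
      (forall (j : nat) (a : arcs I), onth s j = Some a ->
         imem m 1 j%:Z = arc_number a /\ imem m 2 j%:Z = g a)
    & (forall a, [/\ imem m 3 (arc_number a) = lower I a,
                     imem m 4 (arc_number a) = upper I a
                   & rmem m 0 (arc_number a) = x a])].

Definition output_listing (s : seq (arcs I)) (m : memory R) : Prop :=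
  imem m 5 0 = (size s)%:Z /\
  (forall (j : nat) (a : arcs I), onth s j = Some a ->
     imem m 6 j%:Z = arc_number a).

Lemma take_rcons_onth (s : seq (arcs I)) j : (j < size s)%N ->
  exists2 a, onth s j = Some a & take j.+1 s = rcons (take j s) a.
Proof.
move=> js; case: s js => // b s js; exists (nth b (b :: s) j).
  by rewrite onthE (nth_map b).
exact: take_nth.
Qed.

Lemma output_listing_rcons s a m :
  imem m 1 (imem m 7 0) = arc_number a -> output_listing s m ->
  output_listing (rcons s a) (run output_arc m).
Proof.
move=> ma [size_s list_s]; split.
  by rewrite /= /upd /= size_s size_rcons; lia.
move=> j b; rewrite onthE map_rcons nth_rcons size_map.
rewrite /= ma size_s /upd /= eqz_nat.
case: (ltngtP j (size s)) => // [js|_ [->]//].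
by rewrite -onthE => /list_s.
Qed.

Lemma exec_neg_tension s m :
  uniq s -> (forall a, (a \in s) = (g a != 0)) -> input_listing s m ->
  rmem m 1 0 = 0 ->
  exists (k : nat) (m' : memory R),
    [/\ exec (for_support subtract_arc_tension) m k m',
        (k <= size s * (cost_bound subtract_arc_tension + 13) + 9)%N,
        input_listing s m' & rmem m' 1 0 = - tension g x].
Proof.
move=> us sg ms m0.
pose inv j m := input_listing s m /\
  rmem m 1 0 = - \sum_(a <- take j s) (g a)%:~R * x a.
have [//|j m1 [[[]]]//|//|j m1 js m1j [im1 m1r]||k [m' [e kle [im' m'r]]]] :=
  @exec_for_support R subtract_arc_tension inv (size s) _ _ _ _ m.
- rewrite /inv; have [a sa ->] := take_rcons_onth js; split=> //; split=> //.
  have [_ /(_ _ _ sa)[m1a m1g] /(_ a)[_ _ m1x]] := im1.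
  by rewrite /= /upd /= m1j m1a m1g m1x m1r big_rcons /= opprD addrC.
- by split=> //; rewrite take0 big_nil oppr0.
exists k, m'; split=> //; rewrite m'r take_size /tension big_uniq //=.
congr (- _); rewrite big_mkcond /=; apply: eq_bigr => a _.
by rewrite sg; case: eqP => //= ->; rewrite mul0r.
Qed.

Lemma exec_select s m :
  uniq s -> (forall a, (a \in s) = (g a != 0)) -> input_listing s m ->
  rmem m 1 1 = (period I)%:R / modT I (- tension g x) -> imem m 5 0 = 0 ->
  exists (k : nat) (m' : memory R),
    [/\ exec (for_support select_arc) m k m',
        (k <= size s * (cost_bound select_arc + 13) + 9)%N
      & output_memory m' (flip_set g x)].
Proof.
move=> us sg ms mr m5; set r := _ / _ in mr.
pose inv j m := [/\ input_listing s m, rmem m 1 1 = r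
  & output_listing [seq a <- take j s | a \in flip_set g x] m].
have [//|j m1 [[[]]]//|//|j m1 js m1j [im1 m1r om1]|
      |k [m' [e kle [_ _ om']]]] :=
  @exec_for_support R select_arc inv (size s) _ _ _ _ m.
- rewrite /inv; have [a sa ->] := take_rcons_onth js.
  have ga : g a != 0 by rewrite -sg; apply/onthP; exists j.
  have [_ /(_ _ _ sa)[m1a m1g] /(_ a)[m1l m1u m1x]] := im1.
  have -> : run select_arc m1 =
      if a \in flip_set g x then run output_arc m1 else m1.
    rewrite /= m1j m1a m1g m1l m1u m1x m1r !inE -/r.
    by case: (ltrgtP (g a) 0) ga => //= ga _; rewrite ?orbF.
  rewrite /inv filter_rcons; case: ifP => _ //; split=> //; split=> //.
  by apply: output_listing_rcons om1; rewrite m1j.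
- by split=> //; rewrite take0; split=> // j a; rewrite onth0n.
exists k, m'; split=> //; move: om'; rewrite take_size => -[m'5 m'6].
exists [seq a <- s | a \in flip_set g x]; split=> //.
split=> [|a]; first exact: filter_uniq.
(* The flip set lies in the support, so filtering the support list misses no arc. *)
rewrite mem_filter sg !inE.
by case: (ltrgtP (g a) 0) => //= ga; rewrite ?andbT.
Qed.

Lemma exec_flip_set_prog m : (0 < support_size g)%N -> input_memory g x m ->
  exists (k : nat) (m' : memory R),
    [/\ exec flip_set_prog m k m',
        (k <= (cost_bound subtract_arc_tension + cost_bound select_arc
               + cost_bound set_ratio + 60) * support_size g)%N
      & output_memory m' (flip_set g x)].
Proof.
move=> g0 [s [[us sg] [mT mg] ma mb]].
have size_s : support_size g = size s.
  rewrite /support_size -(card_uniqP us).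
  by apply: eq_card => a; rewrite inE sg.
rewrite size_s in g0 mg *.
have [k1 [m1 [e1 c1 im1 m1r]]] := @exec_neg_tension s
  (Memory (imem m) (upd (rmem m) 1 0 0)) us sg (And3 (conj mT mg) ma mb) erefl.
have [k2 e2 c2] := @exec_loop_free R set_ratio m1 erefl.
(* [set_ratio] writes only to real array 1 and integer array 5, so [im1] still describes the input
   by computation. *)
have [|//|k3 [m3 [e3 c3 om3]]] := @exec_select s (run set_ratio m1) us sg im1.
  by have [[m1T _] _ _] := im1; rewrite /= /upd /= m1T m1r.
exists (4 + (k1 + (k2 + k3)))%N, m3; split=> //.
  by apply: ExecSeq (ExecSeq e1 (ExecSeq e2 e3)); apply: ExecRSet.
(* The loops cost [13 + 13] per arc beyond their bodies; the constants [4 + 9 + 9] and the cost of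
   [set_ratio] are absorbed because the support is nonempty. *)
move: c1 c2 c3 g0; move: (cost_bound _) (cost_bound _) (cost_bound _) (size s).
by nia.
Qed.

End FlipSetProgram.

Theorem theorem4p7 (R : realType) :
  (forall (I : pesp R) (B : {fset {ffun arcs I -> int}})
      (x : {ffun arcs I -> R}) (z : {ffun B -> R}) (g : {ffun arcs I -> int}),
    integral_cycle_basis B -> in_polytope x z -> in_cycle_space g ->
    ~ (exists k : int, tension g x = (period I)%:R * k%:~R) ->
    maximally_violated x g (flip_set g x)) /\
  (exists (p : prog) (C : nat),
    forall (I : pesp R) (B : {fset {ffun arcs I -> int}})
      (x : {ffun arcs I -> R}) (z : {ffun B -> R}) (g : {ffun arcs I -> int}),
    integral_cycle_basis B -> in_polytope x z -> in_cycle_space g ->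
    ~ (exists k : int, tension g x = (period I)%:R * k%:~R) ->
    forall m : memory R, input_memory g x m ->
    exists (n : nat) (m' : memory R) (F : {set arcs I}),
      [/\ exec p m n m', (n <= C * support_size g)%N,
          output_memory m' F & maximally_violated x g F]).
Proof.
split=> [I B x z g _ [_ xb] _ gT|]; first exact: flip_set_maximally_violated.
exists flip_set_prog; eexists => I B x z g _ [_ xb] _ gT m mgx.
(* With empty support the tension would be [0], a multiple of the period. *)
have g0 : (0 < support_size g)%N.
  rewrite lt0n; apply/eqP => /cards0_eq g0; case: gT; exists 0.
  rewrite mulr0 /tension big1 // => a _.
  by move/setP/(_ a): g0; rewrite !inE => /negbFE/eqP->; rewrite mul0r.
have [n [m' [e c om']]] := exec_flip_set_prog g0 mgx.
exists n, m', (flip_set g x).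
split; [exact: e | exact: c | exact: om' |].
exact: flip_set_maximally_violated.
Qed.
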